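(* The following sequences satisfy the $q$-Gauss congruences of order $3$: (1) $f_n(q) = {an \brack bn}_q$, for fixed integers $a \ge b \ge 1$; (2) $g_n(q) = \sum_{k=0}^{n} {n \brack k}_q^2 {n+k \brack k}_q^2 q^{f(n,k)}$, where $f(x,y) = y^2 + Axy + Bx^2 \in \mathbb{Z}[x,y]$ is a polynomial with $f(n,k) \ge 0$ for all integers $n,k\ge 0$; (3) $h_n(q) = \sum_{0 \le \ell \le k \le n,\ n \le k+\ell} {n \brack k}_q^2 {n \brack \ell}_q {k \brack \ell}_q {k+\ell \brack n}_q q^{f(n,k,\ell)}$, where $f(x,y,z) = y^2+z^2+Ax^2+Bxy+Cxz+Dyz \in \mathbb{Z}[x,y,z]$ is a polynomial with $f(n,k,\ell)\ge 0$ for all integers $n,k,\ell \ge 0$.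
   Context: $[n]_q = \frac{q^n-1}{q-1}$, $[n]_q!=\prod_{i=1}^n [i]_q$, $[0]_q!=1$, ${n \brack k}_q = \frac{[n]_q!}{[k]_q![n-k]_q!}$. $\mu$ is the Möbius function. $\mu_n = \{e^{2\pi i j/n}: j \in \mathbb{Z}\}$, and $\mathrm{ord}(\omega)$ is the multiplicative order of a root of unity $\omega$. A sequence $\{a_n(q)\}_{n\ge1}\subseteq \mathbb{Z}[q]$ satisfies the $q$-Gauss congruences if for every $n\ge1$, $\sum_{d\mid n}\mu(d)a_{n/d}(q^d)$ is divisible by $[n]_q$ in $\mathbb{Z}[q]$. For a positive integer $r$, it satisfies the $q$-Gauss congruences of order $r$ if it satisfies the $q$-Gauss congruences and, in addition, for all $n \ge 1$ and $1 \le j \le r-1$, the function $\mu_n \to \mathbb{C}$, $\omega \mapsto \omega^j a_n^{(j)}(\omega)$ depends only on $\mathrm{ord}(\omega)$ (here $a_n^{(j)}$ is the $j$-th derivative in $q$). *)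

(* Defs.v *)
From mathcomp Require Import all_boot all_order all_algebra.
From mathcomp Require Import classical_sets reals trigo.
From mathcomp.real_closed Require Import complex.
From mathcomp Require Import ring.

Set Implicit Arguments.
Unset Strict Implicit.
Unset Printing Implicit Defensive.

Import GRing.Theory.

Local Open Scope ring_scope.
Local Open Scope complex_scope.

(* q is the indeterminate 'X of {poly int}.  The divisors below are monic and
   the divisions are exact: see qintM and qbinomM. *)
Definition qint (n : nat) : {poly int} := ('X^n - 1) %/ ('X - 1).

Definition qfact (n : nat) : {poly int} := \prod_(1 <= i < n.+1) qint i.

Definition qbinom (n k : nat) : {poly int} :=
  if (k <= n)%N then qfact n %/ (qfact k * qfact (n - k)) else 0.

Definition moebius (n : nat) : int :=
  if all (fun p => logn p n == 1%N) (primes n) then (-1) ^+ size (primes n)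
  else 0.

(* Divisibility is spelled out since %| on {poly int} is only up to
   pseudo-division. *)
Definition q_gauss (a : nat -> {poly int}) : Prop :=
  forall n : nat, (0 < n)%N ->
    exists c : {poly int},
      \sum_(d <- divisors n) moebius d *: (a (n %/ d)%N \Po 'X^d)
      = qint n * c.

(* exp (2 i pi j / n), by Euler's formula *)
Definition root_unity (R : realType) (n : nat) (j : int) : R[i] :=
  let t : R := 2 * pi * j%:~R / n%:R in cos t +i* sin t.

Definition mu_ (R : realType) (n : nat) : set R[i] :=
  [set z | exists j : int, z = root_unity R n j]%classic.

Definition ceval (R : realType) (p : {poly int}) (z : R[i]) : R[i] :=
  (map_poly intr p).[z].

(* m.-primitive_root w states that the multiplicative order of w is m. *)
Definition depends_only_on_ord (R : realType) (n : nat) (F : R[i] -> R[i]) :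
    Prop :=
  forall (m : nat) (w w' : R[i]), mu_ n w -> mu_ n w' ->
    m.-primitive_root w -> m.-primitive_root w' -> F w = F w'.

Definition q_gauss_order (R : realType) (r : nat) (a : nat -> {poly int}) :
    Prop :=
  q_gauss a /\
  forall n j : nat, (0 < n)%N -> (1 <= j <= r - 1)%N ->
    depends_only_on_ord n (fun w : R[i] => w ^+ j * ceval (a n)^`(j) w).

Definition f_seq (a b n : nat) : {poly int} := qbinom (a * n) (b * n).

(* The exponents are integers assumed nonnegative on the relevant arguments,
   so that absz is just their conversion to nat. *)
Definition g_exp (A B x y : int) : int := y ^+ 2 + A * x * y + B * x ^+ 2.

Definition g_seq (A B : int) (n : nat) : {poly int} :=
  \sum_(0 <= k < n.+1)
    qbinom n k ^+ 2 * qbinom (n + k) k ^+ 2 * 'X^(absz (g_exp A B n k)).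

Definition h_exp (A B C D x y z : int) : int :=
  y ^+ 2 + z ^+ 2 + A * x ^+ 2 + B * x * y + C * x * z + D * y * z.

Definition h_seq (A B C D : int) (n : nat) : {poly int} :=
  \sum_(0 <= k < n.+1) \sum_(0 <= l < k.+1 | (n <= k + l)%N)
    qbinom n k ^+ 2 * qbinom n l * qbinom k l * qbinom (k + l) n
    * 'X^(absz (h_exp A B C D n k l)).

Lemma qintE n : qint n = \sum_(i < n) 'X^i.
Proof.
rewrite /qint subrX1 mulrC Pdiv.IdomainMonic.mulpK //.
by rewrite -[1]/(1%:P) monicXsubC.
Qed.

Lemma qintM n : qint n * ('X - 1) = 'X^n - 1.
Proof. by rewrite qintE mulrC -subrX1. Qed.

Lemma qint_monic n : (0 < n)%N -> qint n \is monic.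
Proof.
move=> n0; have h := monicXsubC (1 : int).
by rewrite -(monicMr _ h) qintM -[1]/(1%:P) monicXnsubC.
Qed.

Lemma qfact_monic n : qfact n \is monic.
Proof.
rewrite /qfact big_nat; apply: monic_prod => i /andP[i0 _].
exact: qint_monic.
Qed.

Lemma qfactS n : qfact n.+1 = qint n.+1 * qfact n.
Proof. by rewrite /qfact big_nat_recr //= mulrC. Qed.

Lemma qintD m n : qint (m + n) = qint m + 'X^m * qint n.
Proof.
rewrite !qintE big_split_ord /= mulr_sumr; congr (_ + _).
by apply: eq_bigr => i _; rewrite exprD.
Qed.

Lemma qfact_dvd m n : exists c, qfact (m + n) = c * (qfact m * qfact n).
Proof.
have [s] := ubnP (m + n); elim: s m n => // s IH [|m] [|n] /= h.
- by exists 1; rewrite /qfact !big_geq // !mulr1.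
- by exists 1; rewrite mul1r {2}/qfact big_geq // mul1r.
- by exists 1; rewrite addn0 mul1r [qfact 0]big_geq // mulr1.
have [|c1 e1] := IH m n.+1; first by rewrite addSn in h.
have [|c2 e2] := IH m.+1 n; first by rewrite addnS in h.
exists (c1 + 'X^(m.+1) * c2).
have e : qfact (m.+1 + n.+1) = qint (m.+1 + n.+1) * qfact (m + n.+1).
  by rewrite addSn qfactS.
rewrite e qintD mulrDl {1}e1 -addSnnS e2 !qfactS; ring.
Qed.

Lemma qbinomM n k : (k <= n)%N ->
  qbinom n k * (qfact k * qfact (n - k)) = qfact n.
Proof.
move=> kn; have [c e] := qfact_dvd k (n - k); rewrite subnKC // in e.
rewrite /qbinom kn e Pdiv.IdomainMonic.mulpK //.
by rewrite monicMl ?qfact_monic.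
Qed.

Lemma mu_unity_root (R : realType) n (z : R[i]) :
  (0 < n)%N -> mu_ n z -> n.-unity_root z.
Proof.
move=> n0 [j ->]; apply/unity_rootP; rewrite /root_unity /=.
set t := (X in cos X).
have E k : (cos t +i* sin t) ^+ k = cos (k%:R * t) +i* sin (k%:R * t).
  elim: k => [|k IH]; first by rewrite !mul0r cos0 sin0.
  rewrite exprS IH -(addn1 k) natrD mulrDl mul1r cosD sinD.
  by apply/eqP; rewrite eq_complex /=; apply/andP; split; apply/eqP; ring.
have nt : n%:R * t = pi *+ 2 * j%:~R.
  rewrite mulrC /t divfK ?mulr_natl // Num.Theory.pnatr_eq0 -lt0n; exact: n0.
have C (k : nat) : cos (pi *+ 2 * k%:R) = 1 :> R /\ sin (pi *+ 2 * k%:R) = 0 :> R.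
  elim: k => [|k [c s]]; first by rewrite mulr0 cos0 sin0.
  rewrite -(addn1 k) natrD mulrDr mulr1.
  rewrite [cos _]cosD [sin (_ + pi *+ 2)]sinD c s cos2pi.
  have s2 : sin (pi *+ 2) = 0 :> R by rewrite sin_mulr2n sinpi mulr0 mul0rn.
  by rewrite s2 !(mulr0, mul0r, mulr1, subr0, addr0).
rewrite E nt; case: j {t E nt} => k.
  by have [c s] := C k; rewrite c s.
have [c s] := C k.+1.
by rewrite NegzE mulrNz mulrN cosN sinN c s oppr0.
Qed.

(* Main.v *)
(* Write q = w (1 + t) with w a primitive m-th root of unity, m | n: the
   derivative condition of order 3 says that the expansion of a_n modulo t^3
   depends on m only.  Modulo t^3 every summand of the sums at hand is either a
   product of q-binomials [mN, mK] and of powers of 1 + t, or contains two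
   factors [mN, mK + r] with 0 < r < m.  Each of these vanishes to first order,
   and the exponent of q is such that their product contributes an integer,
   independent of w, times t^2 w^r / (w^r - 1)^2.  The sum of these weights over
   r is a sum over all nontrivial m-th roots of unity, hence depends on m only.
   The same computation applied to the q-Chu-Vandermonde sum for [m + mN, mK]
   shows by induction on N that the expansions of the [mN, mK] modulo t^3
   depend on m only.

   The q-Gauss congruences hold because q-Lucas gives a_{mN}(w) = a_N(1): at a
   root of order m > 1 the terms d and pd of the Moebius sum cancel, for any
   prime p | m not dividing d. *)
Require Import Defs.
From HB Require Import structures.
From mathcomp Require Import all_boot all_order all_algebra all_field.
From mathcomp Require Import reals complex.
From mathcomp Require Import ring zify.

Set Implicit Arguments.
Unset Strict Implicit.
Unset Printing Implicit Defensive.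

Import GRing.Theory.
Local Open Scope ring_scope.

(** * Identities between q-binomials over the integers *)

Lemma qfact0 : qfact 0 = 1.
Proof. by rewrite /qfact big_geq. Qed.

Lemma qfact_neq0 n : qfact n != 0.
Proof. exact: monic_neq0 (qfact_monic n). Qed.

Lemma qbinom_small n k : (n < k)%N -> qbinom n k = 0.
Proof. by rewrite /qbinom ltnNge => /negbTE->. Qed.

Lemma qbinom_sub n k : (k <= n)%N -> qbinom n (n - k) = qbinom n k.
Proof. by move=> kn; rewrite /qbinom leq_subr kn subKn // mulrC. Qed.

Lemma qbinomn0 n : qbinom n 0 = 1.
Proof.
have := qbinomM (leq0n n); rewrite subn0 qfact0 mul1r => h.
by apply: (mulIf (qfact_neq0 n)); rewrite h mul1r.
Qed.

Lemma qbinomnn n : qbinom n n = 1.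
Proof. by rewrite -{2}(subn0 n) qbinom_sub ?qbinomn0. Qed.

Lemma qbinomS n k :
  qbinom n.+1 k.+1 = qbinom n k + 'X^(k.+1) * qbinom n k.+1.
Proof.
have [nk|kn|->] := ltngtP n k.
- by rewrite !qbinom_small ?mulr0 ?addr0 // ltnW.
- have h1 := @qbinomM n.+1 k.+1 (ltnW kn).
  have h2 := @qbinomM n k (ltnW kn); have h3 := @qbinomM n k.+1 kn.
  have e : (n - k = (n - k.+1).+1)%N by lia.
  rewrite subSS in h1; rewrite e qfactS in h1 h2.
  have q0 : qfact k.+1 * qfact (n - k.+1).+1 != 0.
    by rewrite mulf_neq0 ?qfact_neq0.
  have d : qint n.+1 = qint k.+1 + 'X^(k.+1) * qint (n - k.+1).+1.
    by rewrite -qintD; congr qint; lia.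
  apply: (mulIf q0).
  rewrite {1}qfactS h1 qfactS d mulrDl -{1}h2 -h3 !qfactS; ring.
- by rewrite !qbinomnn qbinom_small // mulr0 addr0.
Qed.

(** Evaluated at a root of unity, this absorption identity shows that some q-binomials vanish there;
    differentiated, it gives their first-order coefficients. *)
Lemma mul_qbinom_diag n k :
  ('X^(k.+1) - 1) * qbinom n.+1 k.+1 = ('X^(n.+1) - 1) * qbinom n k.
Proof.
have [nk|kn] := ltnP n k; first by rewrite !qbinom_small ?mulr0.
have h1 := @qbinomM n.+1 k.+1 kn; have h2 := @qbinomM n k kn.
rewrite subSS !qfactS in h1.
have q0 : qfact k * qfact (n - k) != 0 by rewrite mulf_neq0 ?qfact_neq0.
rewrite -!qintM; apply: (mulIf q0).
transitivity (('X - 1) *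
    (qbinom n.+1 k.+1 * (qint k.+1 * qfact k * qfact (n - k)))).
  by ring.
by rewrite h1 -h2; ring.
Qed.

(** Induction on [m], with the q-Pascal rule used on [m + n] as well as on each [qbinom m.+1 i.+1]
    of the sum. *)
Lemma qbinom_Vandermonde m n k :
  qbinom (m + n) k = \sum_(0 <= j < m.+1 | (j <= k)%N)
    'X^((m - j) * (k - j)) * qbinom m j * qbinom n (k - j).
Proof.
elim: m k => [|m IH] [|k].
- by rewrite big_mkcond big_nat1 /= !qbinomn0 !mulr1 mul0n.
- by rewrite big_mkcond big_nat1 /= qbinomn0 mulr1 mul0n mul1r.
- rewrite big_mkcond big_nat_recl //= !qbinomn0 muln0 !mulr1 big1 ?addr0 //.
rewrite addSn qbinomS !IH mulr_sumr [RHS]big_mkcond big_nat_recl //=.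
rewrite !(big_mkcond (fun j => (j <= _)%N)) /= [in X in _ + X]big_nat_recl //=.
have -> : \sum_(0 <= i < m.+1)
    (if (i < k.+1)%N then
       'X^((m.+1 - i.+1) * (k.+1 - i.+1)) * qbinom m.+1 i.+1 *
       qbinom n (k.+1 - i.+1)
     else 0) =
  \sum_(0 <= i < m.+1) (if (i <= k)%N then
       'X^((m - i) * (k - i)) * qbinom m i * qbinom n (k - i) else 0) +
  \sum_(0 <= i < m) (if (i < k.+1)%N then 'X^(k.+1) *
       ('X^((m - i.+1) * (k.+1 - i.+1)) * qbinom m i.+1 *
        qbinom n (k.+1 - i.+1))
     else 0).
  (* Padding by one zero term gives all sums the same range, so that the q-Pascal rule applies term
     by term. *)
  have -> (F : nat -> {poly int}) :
      F m = 0 -> \sum_(0 <= i < m) F i = \sum_(0 <= i < m.+1) F i.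
    by move=> Fm; rewrite big_nat_recr //= Fm addr0.
  2: by rewrite (@qbinom_small m m.+1) // !(mulr0, mul0r) if_same.
  rewrite -big_split /=; apply: eq_big_nat => i /andP[_ im].
  rewrite ltnS; case: (leqP i k) => [ik|_]; last by rewrite addr0.
  rewrite qbinomS !subSS mulrDr mulrDl; congr (_ + _).
  case: (ltnP i m) => [lim|mi]; last first.
    by rewrite (@qbinom_small m i.+1) // !(mulr0, mul0r).
  rewrite !mulrA -!exprD; congr ('X^_ * _ * _).
  have -> : (m - i = (m - i.+1).+1)%N by lia.
  by rewrite mulSn; lia.
rewrite !qbinomn0 !subn0 !mulr1 mulrA -exprD -mulSn; ring.
Qed.

(** * Values at primitive roots of unity and the q-Lucas theorem *)

(** Generalises [ceval]: values are taken in [algC] for the congruences and in [R[i]] for the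
    derivatives. *)
Definition zeval (F : comNzRingType) (w : F) (p : {poly int}) : F :=
  (map_poly intr p).[w].

HB.instance Definition _ (F : comNzRingType) (w : F) :=
  GRing.RMorphism.copy (zeval w) (horner_eval w \o map_poly intr).

Lemma zevalXn (F : comNzRingType) (w : F) n : zeval w 'X^n = w ^+ n.
Proof. by rewrite /zeval map_polyXn hornerXn. Qed.

Lemma mul_qbinom_diag_eval (F : comNzRingType) (w : F) n k :
  (w ^+ k.+1 - 1) * zeval w (qbinom n.+1 k.+1) =
  (w ^+ n.+1 - 1) * zeval w (qbinom n k).
Proof.
have := congr1 (zeval w) (mul_qbinom_diag n k).
by rewrite !rmorphM !rmorphB rmorph1 /= !zevalXn.
Qed.

Section PrimitiveRoot.

Variables (F : fieldType) (m : nat) (w : F).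
Hypothesis prim_w : m.-primitive_root w.

Let m_gt0 : (0 < m)%N := prim_order_gt0 prim_w.

Lemma prim_expr_neq0 k : w ^+ k != 0.
Proof.
rewrite expf_neq0 //; apply/eqP => w0; have := prim_expr_order prim_w.
by rewrite w0 expr0n eqn0Ngt m_gt0 => /eqP; rewrite eq_sym oner_eq0.
Qed.

Lemma prim_expr_sub1_neq0 r : (0 < r < m)%N -> w ^+ r - 1 != 0.
Proof.
move=> /andP[r0 rm]; rewrite subr_eq0 -(expr0 w) (eq_prim_root_expr prim_w).
by rewrite mod0n modn_small // -lt0n.
Qed.

Lemma prim_expr_block K r : w ^+ (m * K + r) = w ^+ r.
Proof. by rewrite exprD exprM (prim_expr_order prim_w) expr1n mul1r. Qed.

Lemma zeval_qbinom_prim r : (0 < r < m)%N -> zeval w (qbinom m r) = 0.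
Proof.
move=> rm; have := mul_qbinom_diag_eval w m.-1 r.-1.
rewrite !prednK //; last by case/andP: rm.
rewrite (prim_expr_order prim_w) subrr mul0r => /eqP.
by rewrite mulf_eq0 (negbTE (prim_expr_sub1_neq0 rm)) => /eqP.
Qed.

(** In the q-Vandermonde sum, [qbinom m j] vanishes at [w] unless [j] is 0 or [m]; at [j = 0] the
    power of [w] is [w ^+ (m * k) = 1]. *)
Lemma zeval_qbinom_addm n k : zeval w (qbinom (m + n) k) =
  zeval w (qbinom n k) +
  (if (m <= k)%N then zeval w (qbinom n (k - m)) else 0).
Proof.
rewrite qbinom_Vandermonde rmorph_sum big_mkcond /= big_nat_recr //= big_ltn //.
rewrite big_nat big1 => [|i im].
  rewrite addr0 !subn0 subnn qbinomn0 qbinomnn mulr1 mul0n !mul1r.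
  rewrite rmorphM /= zevalXn.
  by rewrite -[X in _ ^+ X]addn0 prim_expr_block mul1r.
by case: ifP => // _; rewrite !rmorphM /= zeval_qbinom_prim // mulr0 mul0r.
Qed.

(** Removing one block [m] from the top index by [zeval_qbinom_addm] is Pascal's rule for
    ['C(N, K)]. *)
Lemma zeval_qbinom_Lucas N K a r : (a < m)%N -> (r < m)%N ->
  zeval w (qbinom (m * N + a) (m * K + r)) = 'C(N, K)%:R * zeval w (qbinom a r).
Proof.
move=> am rm; elim: N K => [|N IH] [|K].
- by rewrite !muln0 mul1r.
- by rewrite muln0 bin0n mul0r add0n qbinom_small ?rmorph0 //; lia.
- rewrite mulnS -addnA zeval_qbinom_addm muln0 add0n leqNgt rm addr0.
  by have := IH 0%N; rewrite muln0 !bin0.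
rewrite mulnS -addnA zeval_qbinom_addm IH ifT; last by lia.
have -> : (m * K.+1 + r - m = m * K + r)%N by lia.
by rewrite IH binS natrD mulrDl.
Qed.

Lemma zeval_qbinom_block N K r : (r < m)%N ->
  zeval w (qbinom (m * N) (m * K + r)) = 'C(N, K)%:R * (r == 0)%:R.
Proof.
move=> rm; rewrite -[(m * N)%N]addn0 zeval_qbinom_Lucas //.
by case: r rm => [|r] _; rewrite ?qbinomn0 ?qbinom_small // ?rmorph1 ?rmorph0.
Qed.

Lemma zeval_qbinom_mulm N K a : (a < m)%N ->
  zeval w (qbinom (m * N + a) (m * K)) = 'C(N, K)%:R.
Proof.
move=> am; rewrite -[(m * K)%N]addn0 zeval_qbinom_Lucas //.
by rewrite qbinomn0 rmorph1 mulr1.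
Qed.

(** The value of [qbinom m.-1 r] is (-1)^r w^(-r(r+1)/2); squaring removes the sign and the half.
    The recursion in [r] is the q-Pascal rule for [qbinom m r.+1], which vanishes at [w]. *)
Lemma sqr_zeval_qbinom_pred r : (r < m)%N ->
  zeval w (qbinom m.-1 r) ^+ 2 * w ^+ (r.+1 ^ 2) = w ^+ r.+1.
Proof.
elim: r => [|r IH] rm; first by rewrite qbinomn0 rmorph1 expr1n mul1r.
have := congr1 (zeval w) (qbinomS m.-1 r); rewrite prednK //.
rewrite zeval_qbinom_prim ?rm // rmorphD rmorphM /= zevalXn => /eqP.
rewrite eq_sym addr_eq0 => /eqP e.
have := IH (ltnW rm); rewrite e sqrrN exprMn => h.
have -> : (r.+2 ^ 2 = r.+1 * 2 + r.+1 ^ 2 + 1)%N by lia.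
by rewrite !exprD expr1 exprM (exprS w r.+1) [w * _]mulrC -[in RHS]h; ring.
Qed.
End PrimitiveRoot.

(* Taylor expansion at w in the rescaled variable t, where q = w (1 + t): the
   coefficient of t^j is w^j p^(j)(w) / j!. *)
Definition expansion (F : comNzRingType) (w : F) (p : {poly int}) : {poly F} :=
  map_poly intr p \Po (w *: (1 + 'X)).

HB.instance Definition _ (F : comNzRingType) (w : F) :=
  GRing.RMorphism.copy (expansion w)
    (comp_poly (w *: (1 + 'X)) \o map_poly intr).

Section Expansion.

Variables (F : comNzRingType) (w : F).
Implicit Types p : {poly int}.

Lemma expansionXn n : expansion w 'X^n = w ^+ n *: (1 + 'X) ^+ n.
Proof. by rewrite /expansion map_polyXn comp_Xn_poly exprZn. Qed.

Lemma expansion_coef0 p : (expansion w p)`_0 = zeval w p.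
Proof.
by rewrite -horner_coef0 horner_comp !hornerE.
Qed.

Lemma deriv_expansion p : (expansion w p)^`() = w *: expansion w p^`().
Proof.
rewrite /expansion deriv_comp deriv_map derivZ derivD derivX -(polyC1 F) derivC.
by rewrite add0r -scalerAr mulr1.
Qed.

Lemma expansion_coef1 p : (expansion w p)`_1 = w * zeval w p^`().
Proof.
by rewrite -expansion_coef0 -coefZ -deriv_expansion coef_deriv.
Qed.

Lemma expansion_coef2 p :
  (expansion w p)`_2 *+ 2 = w ^+ 2 * zeval w p^`(2).
Proof.
rewrite derivnS /= -derivn1 /= expr2 -mulrA -expansion_coef1 -coefZ.
by rewrite -deriv_expansion coef_deriv.
Qed.

End Expansion.

(** * First-order coefficients of the q-binomials that vanish at a root of unity *)

Lemma coef1M (R : comNzRingType) (p q : {poly R}) :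
  (p * q)`_1 = p`_0 * q`_1 + p`_1 * q`_0.
Proof. by rewrite coefM !big_ord_recl big_ord0 addr0. Qed.

Lemma coef2M (R : comNzRingType) (p q : {poly R}) :
  (p * q)`_2 = p`_0 * q`_2 + p`_1 * q`_1 + p`_2 * q`_0.
Proof. by rewrite coefM !big_ord_recl big_ord0 addr0 !addrA. Qed.

Section PrimitiveRootExpansion.

Variables (F : fieldType) (m : nat) (w : F).
Hypothesis prim_w : m.-primitive_root w.

(** Compare the coefficients of t in [mul_qbinom_diag]: both this q-binomial and q^(mN) - 1 vanish
    at [w], so the product rule leaves one term on each side, and q-Lucas evaluates the remaining
    q-binomial. *)
Lemma expansion_qbinom_coef1 N K r : (0 < r < m)%N ->
  (expansion w (qbinom (m * N) (m * K + r)))`_1 =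
  (m * N * 'C(N.-1, K))%:R * (zeval w (qbinom m.-1 r.-1) / (w ^+ r - 1)).
Proof.
move=> rm; have [r0 lt_rm] := andP rm; have m0 := prim_order_gt0 prim_w.
have w0 : w != 0 by rewrite -[w]expr1 (prim_expr_neq0 prim_w).
have w1 := prim_expr_sub1_neq0 prim_w rm.
case: N => [|N].
  by rewrite muln0 mul0r qbinom_small ?rmorph0 ?coef0 //; lia.
have := mul_qbinom_diag (m * N.+1).-1 (m * K + r).-1.
rewrite !prednK; [|lia|lia].
move=> /(congr1 (fun p => (expansion w p)`_1)).
rewrite !rmorphM !rmorphB rmorph1 /= !coef1M !coefB !coef1 !subr0.
rewrite !expansion_coef0 !expansion_coef1 !zevalXn !derivXn.
rewrite !rmorphMn /= !zevalXn.
have wN k : w ^+ (m * k) = 1 by rewrite exprM (prim_expr_order prim_w) expr1n.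
rewrite (zeval_qbinom_block prim_w) // !(prim_expr_block prim_w).
rewrite wN subrr mul0r add0r.
rewrite (gtn_eqF r0) !mulr0 addr0.
have -> : w * (w ^+ (m * N.+1).-1 *+ (m * N.+1)) = (m * N.+1)%:R.
  rewrite mulrnAr -exprS prednK; last by lia.
  by rewrite wN.
have -> : ((m * N.+1).-1 = m * N + m.-1)%N by lia.
have -> : ((m * K + r).-1 = m * K + r.-1)%N by lia.
rewrite (zeval_qbinom_Lucas prim_w); [|lia|lia].
move=> e; apply: (mulfI w1); rewrite e natrM; field; exact: w1.
Qed.

Definition root_weight (r : nat) : F := w ^+ r / (w ^+ r - 1) ^+ 2.

(** By [sqr_zeval_qbinom_pred], the factor [w ^+ (r ^ 2)] turns the square of [qbinom m.-1 r.-1]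
    into [w ^+ r]. This is why exponents of q congruent to r^2 modulo [m] are wanted. *)
Lemma sqr_expansion_qbinom_coef1 N K N' K' r : (0 < r < m)%N ->
  (expansion w (qbinom (m * N) (m * K + r)))`_1 *
  (expansion w (qbinom (m * N') (m * K' + r)))`_1 * w ^+ (r ^ 2) =
  (m * N * 'C(N.-1, K) * (m * N' * 'C(N'.-1, K')))%:R * root_weight r.
Proof.
move=> rm; rewrite !expansion_qbinom_coef1 //.
have [r0 lt_rm] := andP rm.
have := @sqr_zeval_qbinom_pred _ _ _ prim_w r.-1; rewrite prednK // => e.
rewrite /root_weight -[X in _ = _ * (X / _)]e; last by lia.
by rewrite natrM; field; exact: (prim_expr_sub1_neq0 prim_w rm).
Qed.

End PrimitiveRootExpansion.

(** * Expansions modulo t^3 that depend only on the order of the root *)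

Lemma prim_root_exprs_uniq (F : fieldType) m (w : F) :
  m.-primitive_root w -> uniq [seq w ^+ r | r <- iota 0 m].
Proof.
move=> prim_w; rewrite map_inj_in_uniq ?iota_uniq // => i j.
rewrite !mem_iota add0n => /= im jm /eqP.
by rewrite (eq_prim_root_expr prim_w) !modn_small // => /eqP.
Qed.

Lemma mem_prim_root_exprs (F : fieldType) m (w x : F) :
  m.-primitive_root w ->
  (x \in [seq w ^+ r | r <- iota 0 m]) = (x ^+ m == 1).
Proof.
move=> prim_w; apply/mapP/eqP => [[r _ ->]|/(prim_rootP prim_w)[i ->]].
  by rewrite exprAC (prim_expr_order prim_w) expr1n.
by exists (i : nat) => //; rewrite mem_iota /=.
Qed.

(** The weight of index [r] is a function of [w ^+ r] alone, and the powers of either root run over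
    all m-th roots of unity. *)
Lemma sum_root_weight (F : fieldType) m (w w' : F) :
  m.-primitive_root w -> m.-primitive_root w' ->
  \sum_(1 <= r < m) root_weight w r = \sum_(1 <= r < m) root_weight w' r.
Proof.
move=> prim_w prim_w'; have m0 := prim_order_gt0 prim_w.
have E v : \sum_(1 <= r < m) root_weight v r =
    \sum_(x <- [seq v ^+ r | r <- iota 0 m]) x / (x - 1) ^+ 2.
  (* The weight of the root 1, at r = 0, is 1 / 0 = 0. *)
  rewrite big_map -{2}[m]subn0 -[iota _ _]/(index_iota 0 m) [RHS]big_ltn //.
  by rewrite expr0 subrr expr0n invr0 mulr0 add0r.
rewrite !E; apply: perm_big; apply: uniq_perm.
- exact: prim_root_exprs_uniq.
- exact: prim_root_exprs_uniq.
by move=> x; rewrite !mem_prim_root_exprs.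
Qed.

Lemma Vandermonde_exponent m K r : (r <= m)%N ->
  (m - r) * (m * K.+1 - r) = r ^ 2 %[mod m].
Proof.
move=> rm; rewrite -(modnMDl r) -[RHS](modnMDl ((m - r) * K.+1)).
congr (_ %% _)%N; set s := (m - r)%N.
have -> : m = (r + s)%N by lia.
have -> : ((r + s) * K.+1 - r = (r + s) * K + s)%N by rewrite mulnS; lia.
by rewrite mulnS; nia.
Qed.

Definition uniform (F : comNzRingType) m (p : {poly int}) :=
  forall w w' : F, m.-primitive_root w -> m.-primitive_root w' ->
  forall i, (i < 3)%N -> (expansion w p)`_i = (expansion w' p)`_i.

(** The constant [a] is fixed before [w]: only the weight varies with the root. *)
Definition second_order (F : fieldType) m r (a : F) (p : {poly int}) :=
  forall w : F, m.-primitive_root w ->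
  [/\ (expansion w p)`_0 = 0, (expansion w p)`_1 = 0
    & (expansion w p)`_2 = a * root_weight w r].

Section Uniform.

Variables (F : fieldType) (m : nat).
Local Notation unif := (uniform F m).
Implicit Types p : {poly int}.

Lemma uniform_gt0 p : ((0 < m)%N -> unif p) -> unif p.
Proof. by move=> h w w' pw; apply: h (prim_order_gt0 pw) _ _ pw. Qed.

Lemma uniformD p1 p2 : unif p1 -> unif p2 -> unif (p1 + p2).
Proof.
move=> h1 h2 w w' pw pw' i i3.
by rewrite !rmorphD !coefD (h1 _ _ pw pw') // (h2 _ _ pw pw').
Qed.

Lemma uniformM p1 p2 : unif p1 -> unif p2 -> unif (p1 * p2).
Proof.
move=> h1 h2 w w' pw pw' i i3; rewrite !rmorphM !coefM.
apply: eq_bigr => j _; have := ltn_ord j => ji.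
by rewrite (h1 _ _ pw pw') 1?(h2 _ _ pw pw') //; lia.
Qed.

Lemma uniformX p n : unif p -> unif (p ^+ n).
Proof.
move=> hp; elim: n => [|n IH]; last by rewrite exprS; apply: uniformM.
by move=> w w' _ _ i _; rewrite !rmorph1.
Qed.

Lemma uniform_sum (I : Type) (s : seq I) (P : pred I) (p : I -> {poly int}) :
  (forall i, P i -> unif (p i)) -> unif (\sum_(i <- s | P i) p i).
Proof.
move=> h; elim/big_rec: _ => [|i q Pi hq].
  by move=> w w' _ _ i _; rewrite !rmorph0.
by apply: uniformD => //; apply: h.
Qed.

Lemma uniformXn n : (m %| n)%N -> unif 'X^n.
Proof.
move=> /dvdnP[k ->] w w' pw pw' i _; rewrite !expansionXn !(mulnC k) !exprM.
by rewrite (prim_expr_order pw) (prim_expr_order pw').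
Qed.

(** Two factors without constant term leave, at t^2, the product of their first-order coefficients
    times the value of the rest. *)
Lemma second_orderM r (a : F) p1 p2 u :
  (forall w, m.-primitive_root w -> [/\ zeval w p1 = 0, zeval w p2 = 0 &
     (expansion w p1)`_1 * (expansion w p2)`_1 * zeval w u =
     a * root_weight w r]) ->
  second_order m r a (p1 * p2 * u).
Proof.
move=> h w pw; have [z1 z2 e] := h w pw.
rewrite !rmorphM /= coef2M !(coef1M, coef2M, coef0M) !expansion_coef0 z1 z2.
split; by rewrite !(mul0r, mulr0, addr0, add0r).
Qed.

Lemma second_order_sum0 r (a : F) (n : nat) (T : nat -> {poly int}) :
  (0 < n)%N ->
  second_order m r a (T 0%N) ->
  (forall s, (0 < s < n)%N -> second_order m r (0 : F) (T s)) ->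
  second_order m r a (\sum_(0 <= s < n) T s).
Proof.
move=> n0 h0 h w pw; have [e0 e1 e2] := h0 w pw.
have z i : (i < 3)%N ->
    (expansion w (\sum_(0 <= s < n) T s))`_i = (expansion w (T 0%N))`_i.
  move=> i3; rewrite big_ltn // rmorphD coefD rmorph_sum coef_sum /=.
  rewrite big_nat big1 ?addr0 // => s /h /(_ w pw)[].
  by case: i i3 => [|[|[|]]] // _; rewrite mul0r.
by rewrite !z.
Qed.

(** Since [a] is common to all [r > 0], these terms add up to [a] times the full sum of weights at
    t^2, where [sum_root_weight] applies. *)
Lemma uniform_block (a : F) (T : nat -> {poly int}) :
  unif (T 0%N) ->
  (forall r, (0 < r < m)%N -> second_order m r a (T r)) ->
  unif (\sum_(0 <= r < m) T r).
Proof.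
move=> h0 h w w' pw pw' i i3; have m0 := prim_order_gt0 pw.
rewrite big_ltn // !rmorphD !coefD (h0 _ _ pw pw') //; congr (_ + _).
rewrite !rmorph_sum !coef_sum /= !big_nat.
case: i i3 => [|[|[|]]] // _.
- by rewrite !big1 // => r /h h1; have [] := h1 _ pw; have [] := h1 _ pw'.
- by rewrite !big1 // => r /h h1; have [] := h1 _ pw; have [] := h1 _ pw'.
transitivity (a * \sum_(1 <= r < m) root_weight w r).
  by rewrite big_nat mulr_sumr; apply: eq_bigr => r /h h1; have [] := h1 _ pw.
rewrite (sum_root_weight pw pw') big_nat mulr_sumr.
by apply: eq_bigr => r /h h1; have [] := h1 _ pw'.
Qed.

Lemma uniform_qbinom N K : unif (qbinom (m * N) (m * K)).
Proof.
apply: uniform_gt0 => m0; elim: N K => [|N IH] [|K].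
- by rewrite muln0 qbinomn0; apply: (@uniformXn 0).
- rewrite qbinom_small ?muln0 //; last by lia.
  by move=> w w' _ _ i _; rewrite !rmorph0.
- by rewrite muln0 qbinomn0; apply: (@uniformXn 0).
have [NK|KN|<-] := ltngtP N K.
- rewrite qbinom_small ?ltn_mul2l ?m0 //.
  by move=> w w' _ _ i _; rewrite !rmorph0.
- rewrite mulnS qbinom_Vandermonde big_mkcond big_nat_recr //=.
  apply: uniformD; last first.
    rewrite ifT; last by lia.
    rewrite subnn qbinomnn mul0n !mul1r mulnS addKn; exact: IH.
  (* The two factors of the constant come from [qbinom m r] and from
     [qbinom (m * N) (m * K.+1 - r)], the latter after reflection of its lower index. *)
  apply: (@uniform_block
    (m * 1 * 'C(1.-1, 0) * (m * N * 'C(N.-1, N - K.+1)))%:R).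
    rewrite !subn0 qbinomn0 mulr1; apply: uniformM; last exact: IH.
    by apply: uniformXn; rewrite dvdn_mulr.
  move=> r rm; rewrite ifT; last by lia.
  have le_KN : (m * K.+1 <= m * N)%N by rewrite leq_mul2l KN orbT.
  (* The reflection gives both vanishing factors the same residue [r], as
     [sqr_expansion_qbinom_coef1] demands. *)
  have -> : qbinom (m * N) (m * K.+1 - r) = qbinom (m * N) (m * (N - K.+1) + r).
    rewrite -qbinom_sub; last by lia.
    by congr (qbinom _ _); rewrite mulnBr; lia.
  have -> : qbinom m r = qbinom (m * 1) (m * 0 + r) by rewrite muln1 muln0.
  rewrite -mulrA mulrC; apply: second_orderM => w pw.
  have rm' := andP rm.
  rewrite !(zeval_qbinom_block pw) ?(gtn_eqF (proj1 rm')) ?mulr0; [|lia|lia].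
  split=> //; rewrite -(sqr_expansion_qbinom_coef1 pw) // zevalXn.
  congr (_ * _); apply/eqP; rewrite (eq_prim_root_expr pw).
  by rewrite Vandermonde_exponent // ltnW; case: rm'.
- by rewrite qbinomnn; apply: (@uniformXn 0).
Qed.

End Uniform.

(** * Sums cut into blocks of length [m], and exponents modulo [m] *)

Lemma sum_blocks (V : nmodType) m N (T : nat -> V) :
  \sum_(0 <= k < m * N) T k =
  \sum_(0 <= K < N) \sum_(0 <= r < m) T (m * K + r)%N.
Proof.
rewrite mulnC big_nat_mul; apply: eq_bigr => K _.
rewrite -{1}[(K * m)%N]add0n big_addn mulSn addnK.
by apply: eq_bigr => r _; rewrite addnC mulnC.
Qed.

(** The last block is only begun by the index [m * N]; zero terms complete it. *)
Lemma sum_blocks_trunc (V : nmodType) m N (T : nat -> V) : (0 < m)%N ->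
  (forall k, (m * N < k)%N -> T k = 0) ->
  \sum_(0 <= k < (m * N).+1) T k =
  \sum_(0 <= K < N.+1) \sum_(0 <= r < m) T (m * K + r)%N.
Proof.
move=> m0 T0; rewrite -sum_blocks.
rewrite (@big_cat_nat _ _ _ (m * N).+1 0 (m * N.+1)) //=; last first.
  by rewrite ltn_mul2l m0 /=.
by rewrite [X in _ + X]big_nat [X in _ + X]big1 ?addr0 // => k /andP[/T0].
Qed.

Lemma absz_eqmod (x z : int) (m y : nat) : 0 <= x ->
  x = y%:Z + z * m%:Z -> absz x = y %[mod m].
Proof.
case: x => // n _ /= e; apply/eqP; rewrite -eqz_nat -!modz_nat e.
by rewrite addrC modzMDl.
Qed.

(** Every monomial except y^2 contains x = mN; the witness is the quotient by [m] of the difference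
    from r^2. *)
Lemma g_exp_mod A B m N K r :
  (forall n k : nat, 0 <= g_exp A B n k) ->
  absz (g_exp A B (m * N)%N (m * K + r)%N) = r ^ 2 %[mod m].
Proof.
move=> f0; apply: (@absz_eqmod _ (m%:Z * K%:Z ^+ 2 + 2 * K%:Z * r%:Z +
   A * N%:Z * (m%:Z * K%:Z + r%:Z) + B * m%:Z * N%:Z ^+ 2)) => //.
by rewrite /g_exp !PoszD !PoszM; ring.
Qed.

(** The condition [r * s = 0] removes the remainder D r s of the cross term. *)
Lemma h_exp_mod A B C D m N K r L s :
  (forall n k l : nat, 0 <= h_exp A B C D n k l) -> (r * s = 0)%N ->
  absz (h_exp A B C D (m * N)%N (m * K + r)%N (m * L + s)%N)
  = r ^ 2 + s ^ 2 %[mod m].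
Proof.
move=> f0 rs0; apply: (@absz_eqmod _ (m%:Z * K%:Z ^+ 2 + 2 * K%:Z * r%:Z +
   m%:Z * L%:Z ^+ 2 + 2 * L%:Z * s%:Z + A * m%:Z * N%:Z ^+ 2 +
   B * N%:Z * (m%:Z * K%:Z + r%:Z) + C * N%:Z * (m%:Z * L%:Z + s%:Z) +
   D * (m%:Z * K%:Z * L%:Z + K%:Z * s%:Z + L%:Z * r%:Z))) => //.
have e : r%:Z * s%:Z = 0 by rewrite -PoszM rs0.
rewrite /h_exp !PoszD !PoszM; apply/eqP; rewrite -subr_eq0.
rewrite -(mulr0 D) -e; apply/eqP; ring.
Qed.

Lemma zeval_Xn_eqmod (F : fieldType) m (w : F) e e' :
  m.-primitive_root w -> e = e' %[mod m] -> zeval w 'X^e = w ^+ e'.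
Proof.
by move=> pw ee; rewrite zevalXn -(prim_expr_mod pw) ee prim_expr_mod.
Qed.

Lemma uniformXn_eqmod0 (F : fieldType) m e :
  e = 0 %[mod m] -> uniform F m 'X^e.
Proof. by move=> e0; apply: uniformXn; rewrite /dvdn e0 mod0n. Qed.

(** * The sums over one and over two summation indices *)

Section Families.

Variables (F : fieldType) (m : nat).

Lemma uniform_qbinom_addn N N' K :
  uniform F m (qbinom (m * N + m * N') (m * K)).
Proof. by rewrite -mulnDr; apply: uniform_qbinom. Qed.

Section Apery.

Variables (A B : int).
Hypothesis f0 : forall n k : nat, 0 <= g_exp A B n k.

Definition g_term (n k : nat) : {poly int} :=
  qbinom n k ^+ 2 * qbinom (n + k) k ^+ 2 * 'X^(absz (g_exp A B n k)).

Lemma g_seq_blocks N : (0 < m)%N -> g_seq A B (m * N) =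
  \sum_(0 <= K < N.+1) \sum_(0 <= r < m) g_term (m * N) (m * K + r).
Proof.
move=> m0; rewrite -(@sum_blocks_trunc _ m N (g_term (m * N))) // => k Nk.
by rewrite /g_term qbinom_small // expr0n !mul0r.
Qed.

Lemma zeval_g_term (w : F) N K r : m.-primitive_root w -> (r < m)%N ->
  zeval w (g_term (m * N) (m * K + r)) =
  ('C(N, K)%:R * (r == 0)%:R) ^+ 2 * 'C(N + K, K)%:R ^+ 2 * w ^+ (r ^ 2).
Proof.
move=> pw rm; rewrite /g_term rmorphM /=.
rewrite (zeval_Xn_eqmod pw (g_exp_mod _ _ _ _ f0)).
rewrite rmorphM !rmorphXn /=.
rewrite (zeval_qbinom_block pw) // addnA -mulnDr (zeval_qbinom_Lucas pw) //.
by rewrite qbinomnn rmorph1 mulr1.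
Qed.

(** Only the terms with [r = 0] survive, and they give the Apéry number of index [N]. *)
Lemma zeval_g_seq (w : F) N : m.-primitive_root w ->
  zeval w (g_seq A B (m * N)) =
  \sum_(0 <= K < N.+1) 'C(N, K)%:R ^+ 2 * 'C(N + K, K)%:R ^+ 2.
Proof.
move=> pw; have m0 := prim_order_gt0 pw.
rewrite g_seq_blocks // rmorph_sum /=; apply: eq_bigr => K _.
rewrite rmorph_sum /= big_nat.
rewrite (eq_bigr _ (fun r rm => zeval_g_term N K pw (proj2 (andP rm)))).
rewrite -big_nat big_ltn // big_nat big1 ?addr0 ?mulr1 // => r /andP[r0 _].
by rewrite (gtn_eqF r0) mulr0 expr0n !mul0r.
Qed.

Lemma uniform_g_seq N : uniform F m (g_seq A B (m * N)).
Proof.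
apply: uniform_gt0 => m0; rewrite g_seq_blocks //; apply: uniform_sum => K _.
(* For [r > 0] the vanishing pair is the square of [qbinom n k]; the last factor is the value of
   [qbinom (n + k) k ^+ 2]. *)
apply: (@uniform_block _ _ ((m * N * 'C(N.-1, K) * (m * N * 'C(N.-1, K)))%:R
  * 'C(N + K, K)%:R ^+ 2)).
  rewrite /g_term; apply: uniformM; last first.
    by apply: uniformXn_eqmod0; rewrite g_exp_mod.
  rewrite addn0; apply: uniformM; apply: uniformX; first exact: uniform_qbinom.
  exact: uniform_qbinom_addn.
move=> r rm; have [r0 lt_rm] := andP rm; rewrite /g_term expr2 -mulrA.
apply: second_orderM => w pw.
rewrite (zeval_qbinom_block pw) // (gtn_eqF r0) mulr0; split=> //.
rewrite rmorphM /= (zeval_Xn_eqmod pw (g_exp_mod _ _ _ _ f0)) rmorphXn /=.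
rewrite addnA -mulnDr (zeval_qbinom_Lucas pw) // qbinomnn rmorph1 mulr1.
by rewrite mulrCA (sqr_expansion_qbinom_coef1 pw) //; ring.
Qed.

End Apery.

Section Triple.

Variables (A B C D : int).
Hypothesis f0 : forall n k l : nat, 0 <= h_exp A B C D n k l.

Definition h_term (n k l : nat) : {poly int} :=
  qbinom n k ^+ 2 * qbinom n l * qbinom k l * qbinom (k + l) n
  * 'X^(absz (h_exp A B C D n k l)).

(** The terms outside the constraints contain [qbinom k l] or [qbinom (k + l) n] equal to zero. On
    the full square, both indices split into blocks independently. *)
Lemma h_seq_square n : h_seq A B C D n =
  \sum_(0 <= k < n.+1) \sum_(0 <= l < n.+1) h_term n k l.
Proof.
rewrite /h_seq; apply: eq_big_nat => k /andP[_ kn].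
rewrite (big_nat_widen _ _ n.+1) // big_mkcond /=; apply: eq_bigr => l _.
rewrite /h_term; case: ifPn => //; rewrite negb_and -ltnNge -leqNgt.
case/orP=> h; first by rewrite (@qbinom_small (k + l)) // mulr0 mul0r.
by rewrite (@qbinom_small k l) // mulr0 !mul0r.
Qed.

Lemma h_seq_blocks N : (0 < m)%N -> h_seq A B C D (m * N) =
  \sum_(0 <= K < N.+1) \sum_(0 <= L < N.+1)
    \sum_(0 <= r < m) \sum_(0 <= s < m) h_term (m * N) (m * K + r) (m * L + s).
Proof.
move=> m0; rewrite h_seq_square sum_blocks_trunc // => [|k Nk]; last first.
  rewrite big1 // => l _.
  by rewrite /h_term qbinom_small // expr0n !mul0r.
apply: eq_bigr => K _; rewrite [RHS]exchange_big /=; apply: eq_bigr => r _.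
rewrite sum_blocks_trunc // => l Nl.
by rewrite /h_term (@qbinom_small _ l) // mulr0 !mul0r.
Qed.
(** Puts in front the pair that vanishes when [k] is not a multiple of [m]. *)
Lemma h_term_sqr n k l : h_term n k l = qbinom n k * qbinom n k *
  (qbinom n l * (qbinom k l *
    (qbinom (k + l) n * 'X^(absz (h_exp A B C D n k l))))).
Proof. by rewrite /h_term expr2 !mulrA. Qed.

(** Puts in front the pair that vanishes when [k] is a multiple of [m] and [l] is not. *)
Lemma h_term_mul n k l : h_term n k l = qbinom n l * qbinom k l *
  (qbinom n k ^+ 2 * (qbinom (k + l) n * 'X^(absz (h_exp A B C D n k l)))).
Proof. by rewrite /h_term; set x := 'X^_; ring. Qed.

(** With [r + s < m] there is no carry in [k + l], so q-Lucas sees the blocks [K + L]. *)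
Lemma zeval_h_tail (w : F) N K L r s : m.-primitive_root w ->
  (r + s < m)%N -> (r * s = 0)%N ->
  zeval w (qbinom (m * K + r + (m * L + s)) (m * N) *
     'X^(absz (h_exp A B C D (m * N)%N (m * K + r)%N (m * L + s)%N))) =
  'C(K + L, N)%:R * w ^+ (r ^ 2 + s ^ 2).
Proof.
move=> pw rsm rs0; rewrite rmorphM /= addnACA -mulnDr (zeval_qbinom_mulm pw) //.
by rewrite (zeval_Xn_eqmod pw (h_exp_mod _ _ _ _ f0 rs0)).
Qed.

Lemma zeval_h_seq (w : F) N : m.-primitive_root w ->
  zeval w (h_seq A B C D (m * N)) =
  \sum_(0 <= K < N.+1) \sum_(0 <= L < N.+1)
    'C(N, K)%:R ^+ 2 * 'C(N, L)%:R * 'C(K, L)%:R * 'C(K + L, N)%:R.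
Proof.
move=> pw; have m0 := prim_order_gt0 pw.
rewrite h_seq_blocks // rmorph_sum /=; apply: eq_bigr => K _.
rewrite rmorph_sum /=; apply: eq_bigr => L _.
rewrite rmorph_sum /= big_ltn // [X in _ + X]big_nat.
rewrite [X in _ + X]big1 => [|r /andP[r0 rm]]; last first.
  rewrite rmorph_sum /= big1 // => s _.
  rewrite h_term_sqr rmorphM rmorphM /= (zeval_qbinom_block pw) //.
  by rewrite (gtn_eqF r0) !mulr0 mul0r.
rewrite addr0 rmorph_sum /= big_ltn // big_nat.
rewrite big1 => [|s /andP[s0 sm]]; last first.
  rewrite h_term_mul rmorphM rmorphM /= (zeval_qbinom_block pw) //.
  by rewrite (gtn_eqF s0) mulr0 !mul0r.
rewrite addr0 h_term_mul rmorphM rmorphM /= rmorphM rmorphXn /= zeval_h_tail //.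
rewrite !(zeval_qbinom_block pw) // -[(0 ^ 2 + 0 ^ 2)%N]/0%N expr0.
rewrite (zeval_qbinom_Lucas pw K L m0 m0) qbinomn0 rmorph1 /=; ring.
Qed.

(** Nested blocks: the term [r = 0] of the outer block is itself a block in [s], while for [r > 0]
    only [s = 0] reaches t^2. *)
Lemma uniform_h_seq N : uniform F m (h_seq A B C D (m * N)).
Proof.
apply: uniform_gt0 => m0; rewrite h_seq_blocks //.
apply: uniform_sum => K _; apply: uniform_sum => L _.
apply: (@uniform_block _ _ ((m * N * 'C(N.-1, K) * (m * N * 'C(N.-1, K)))%:R
  * ('C(N, L)%:R * ('C(K, L)%:R * 'C(K + L, N)%:R)))) => [|r rm].
  apply: (@uniform_block _ _ ((m * N * 'C(N.-1, L) * (m * K * 'C(K.-1, L)))%:R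
    * ('C(N, K)%:R ^+ 2 * 'C(K + L, N)%:R))) => [|s sm].
    rewrite /h_term; apply: uniformM; last first.
      by apply: uniformXn_eqmod0; rewrite h_exp_mod.
    rewrite !addn0; apply: uniformM.
      2: by rewrite -mulnDr; apply: uniform_qbinom.
    apply: uniformM; last exact: uniform_qbinom.
    apply: uniformM; last exact: uniform_qbinom.
    by apply: uniformX; apply: uniform_qbinom.
  have [s0 lt_sm] := andP sm.
  rewrite h_term_mul; apply: second_orderM => w pw.
  have -> : qbinom (m * K + 0) (m * L + s) = qbinom (m * K) (m * L + s).
    by rewrite addn0.
  rewrite !(zeval_qbinom_block pw) // (gtn_eqF s0) !mulr0; split=> //.
  rewrite rmorphM rmorphXn /= zeval_h_tail // (zeval_qbinom_block pw) //.
  rewrite -[(0 ^ 2 + s ^ 2)%N]/(s ^ 2)%N.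
  by rewrite [RHS]mulrAC -(sqr_expansion_qbinom_coef1 pw) //=; ring.
have [r0 lt_rm] := andP rm.
apply: second_order_sum0 => // [|s sm].
  rewrite h_term_sqr; apply: second_orderM => w pw.
  rewrite (zeval_qbinom_block pw) // (gtn_eqF r0) mulr0; split=> //.
  rewrite rmorphM /= rmorphM /= zeval_h_tail ?addn0 ?muln0 //.
  have := zeval_qbinom_mulm pw N L m0; rewrite addn0 => ->.
  rewrite (zeval_qbinom_mulm pw K L lt_rm).
  by rewrite [RHS]mulrAC -(sqr_expansion_qbinom_coef1 pw) //; ring.
(* With [r] and [s] both positive, [qbinom n l] is a third vanishing factor, whence the constant
   0. *)
have [s0 lt_sm] := andP sm.
rewrite h_term_sqr; apply: second_orderM => w pw.
rewrite !(zeval_qbinom_block pw) // (gtn_eqF r0) mulr0; split=> //.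
by rewrite rmorphM /= (zeval_qbinom_block pw) // (gtn_eqF s0) !(mulr0, mul0r).
Qed.

End Triple.
End Families.

(** * Moebius sums and the q-Gauss congruences *)

Lemma perm_primes_mul p d : prime p -> (0 < d)%N -> ~~ (p %| d)%N ->
  perm_eq (primes (p * d)%N) (p :: primes d).
Proof.
move=> pp d0 pd; apply: uniq_perm; rewrite /= ?primes_uniq //.
  by rewrite mem_primes (negbTE pd) !andbF.
move=> q; rewrite in_cons primesM ?(prime_gt0 pp) //.
by rewrite (primes_prime pp) mem_seq1.
Qed.

Lemma moebius_mul p d : prime p -> (0 < d)%N -> ~~ (p %| d)%N ->
  moebius (p * d)%N = - moebius d.
Proof.
move=> pp d0 pd; have perm := perm_primes_mul pp d0 pd.
rewrite /moebius (perm_size perm) (perm_all _ perm) /=.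
have lp q : logn q (p * d) = ((q == p) + logn q d)%N.
  by rewrite lognM ?(prime_gt0 pp) // logn_prime // eq_sym.
rewrite lp eqxx lognE (negbTE pd) !andbF /=.
have -> : all (fun q => logn q (p * d) == 1%N) (primes d) =
          all (fun q => logn q d == 1%N) (primes d).
  apply: eq_in_all => q; rewrite mem_primes lp => /and3P[_ _ qd].
  by have [qp|] := eqVneq q p; rewrite ?add0n //; rewrite qp (negbTE pd) in qd.
by case: ifP; rewrite ?oppr0 // exprS mulN1r.
Qed.

Lemma moebius_sqr p d : prime p -> (0 < d)%N -> (p ^ 2 %| d)%N ->
  moebius d = 0.
Proof.
move=> pp d0 pd; rewrite /moebius; case: ifP => // /allP /(_ p).
rewrite mem_primes pp d0 (dvdn_trans _ pd) ?dvdn_exp // => /(_ isT) /eqP l1.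
by move: pd; rewrite pfactor_dvdn // l1.
Qed.

Lemma sum_moebius_eq0 (V : zmodType) p n (c : nat -> V) :
  prime p -> (p %| n)%N -> (0 < n)%N ->
  (forall d, (p * d %| n)%N -> ~~ (p %| d)%N -> c (p * d)%N = c d) ->
  \sum_(d <- divisors n) c d *~ moebius d = 0.
Proof.
move=> pp pn n0 hc; rewrite (bigID (fun d => p %| d)%N) /=.
rewrite -big_filter.
(* Divisors divisible by p^2 contribute zero; the other multiples of [p] are the [p * d] with [d]
   prime to [p], each of which cancels against [d]. *)
have -> : \sum_(d <- [seq d <- divisors n | (p %| d)%N]) c d *~ moebius d =
  \sum_(d <- [seq (p * d)%N | d <- divisors n & ~~ (p %| d)%N])
    c d *~ moebius d.
  rewrite (bigID (fun d => p ^ 2 %| d)%N) /= big_seq_cond.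
  rewrite big1 ?add0r => [|d]; last first.
    by rewrite mem_filter -dvdn_divisors // =>
         /andP[/andP[_ dn] /moebius_sqr->] //;
       rewrite ?mulr0z // (dvdn_gt0 n0).
  rewrite -big_filter; apply: perm_big; apply: uniq_perm.
  - by rewrite !filter_uniq ?divisors_uniq.
  - rewrite map_inj_uniq ?filter_uniq ?divisors_uniq // => x y /eqP.
    by rewrite eqn_pmul2l ?prime_gt0 // => /eqP.
  move=> d; rewrite !mem_filter -dvdn_divisors //; apply/and3P/mapP.
    move=> [p2 /dvdnP[e de] dn]; rewrite de mulnC in p2 dn *.
    exists e => //; rewrite mem_filter -dvdn_divisors //.
    rewrite (dvdn_trans _ dn) ?dvdn_mull // andbT.
    by apply: contra p2 => pe; rewrite dvdn_pmul2l ?prime_gt0.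
  move=> [e]; rewrite mem_filter -dvdn_divisors // => /andP[pe en] ->.
  split; [by rewrite dvdn_pmul2l ?prime_gt0|by rewrite dvdn_mulr|].
  by rewrite Gauss_dvd ?pn // prime_coprime.
rewrite big_map big_filter -big_split /= big_seq_cond big1 // => d.
rewrite -dvdn_divisors // => /andP[dn pd].
rewrite moebius_mul // ?(dvdn_gt0 n0 dn) // hc //; last first.
  by rewrite Gauss_dvd ?pn // prime_coprime.
by rewrite mulrNz addNr.
Qed.

Lemma zeval_comp_Xn (F : comNzRingType) (w : F) p d :
  zeval w (p \Po 'X^d) = zeval (w ^+ d) p.
Proof. by rewrite /zeval map_comp_poly map_polyXn horner_comp hornerXn. Qed.

(** Division by the monic [qint n] stays over the integers; the remainder has degree below n - 1 but
    vanishes at the n - 1 distinct roots [w ^+ i], so it is zero. *)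
Lemma qint_dvd_of_roots n (w : algC) (p : {poly int}) :
  n.-primitive_root w ->
  (forall i, (0 < i < n)%N -> zeval (w ^+ i) p = 0) ->
  exists c, p = qint n * c.
Proof.
move=> pw roots; have n0 := prim_order_gt0 pw.
have mon := qint_monic n0; have e := Pdiv.IdomainMonic.divp_eq mon p.
exists (p %/ qint n); rewrite mulrC {1}e.
suff -> : p %% qint n = 0 by rewrite addr0.
have zq i : (0 < i < n)%N -> zeval (w ^+ i) (qint n) = 0.
  move=> i0n; have := congr1 (zeval (w ^+ i)) (qintM n).
  rewrite rmorphM !rmorphB rmorph1 /= (zevalXn _ n) (zevalXn _ 1).
  rewrite (exprAC w i n) (prim_expr_order pw).
  rewrite expr1n subrr expr1 => /eqP.
  by rewrite mulf_eq0 (negbTE (prim_expr_sub1_neq0 pw i0n)) orbF => /eqP.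
have inj : injective (intr : int -> algC) by exact: intr_inj.
apply: (map_inj_poly inj) => //; rewrite rmorph0.
apply: (@roots_geq_poly_eq0 _ _ [seq w ^+ i | i <- iota 1 n.-1]).
- rewrite all_map; apply/allP => i; rewrite mem_iota => i1n; apply/rootP.
  have i0n : (0 < i < n)%N by lia.
  have := congr1 (zeval (w ^+ i)) e.
  by rewrite roots // rmorphD rmorphM /= zq // mulr0 add0r => ->.
- have := prim_root_exprs_uniq pw; rewrite -{1}(prednK n0) /=.
  by case/andP.
rewrite size_map size_iota (size_map_inj_poly inj) //.
have sq : size (qint n) = n.
  have := congr1 (size : {poly int} -> nat) (qintM n).
  rewrite size_Mmonic ?monicXsubC ?monic_neq0 // -[1]/(1%:P).
  by rewrite size_XsubC size_XnsubC // addn2 => /= -[].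
have := ltn_modp p (qint n); rewrite sq monic_neq0 //.
by move=> lt_n; rewrite -ltnS (prednK n0).
Qed.

Lemma q_gauss_of_zeval (a : nat -> {poly int}) (b : nat -> algC) :
  (forall m N (w : algC), m.-primitive_root w ->
     zeval w (a (m * N)%N) = b N) ->
  q_gauss a.
Proof.
move=> ab n n0; have [z pz] := C_prim_root_exists n0.
apply: (qint_dvd_of_roots pz) => i i0n.
have wn1 : (z ^+ i) ^+ n = 1 by rewrite exprAC (prim_expr_order pz) expr1n.
have [m pw mn] := prim_order_exists n0 wn1.
set w := z ^+ i in pw *.
have m1 : (1 < m)%N.
  rewrite ltn_neqAle (prim_order_gt0 pw) andbT; apply/eqP => m1.
  have := prim_expr_order pw; rewrite -m1 expr1 => /eqP.
  by rewrite -subr_eq0 (negbTE (prim_expr_sub1_neq0 pz i0n)).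
(* The order of [w ^+ d] is [m %/ gcdn d m], and n/d divided by it is n/lcm(d, m). A prime factor of
   [m] not dividing [d] can be multiplied into [d] without changing this lcm. *)
pose c d := b (n %/ lcmn d m)%N.
have E d : (d %| n)%N -> zeval w (a (n %/ d)%N \Po 'X^d) = c d.
  move=> dn; rewrite /c zeval_comp_Xn -(ab _ _ _ (exp_prim_root pw d)).
  congr (zeval _ (a _)).
  have lcmE : lcmn d m = (d * (m %/ gcdn d m))%N.
    by rewrite muln_divA ?dvdn_gcdr.
  by rewrite lcmE divnMA mulnC divnK // dvdn_divRL // mulnC -lcmE dvdn_lcm dn.
rewrite rmorph_sum /= -[RHS](@sum_moebius_eq0 _ (pdiv m) n c) //.
- rewrite !big_seq; apply: eq_bigr => d; rewrite -dvdn_divisors // => dn.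
  by rewrite -mul_polyC rmorphM /= E // /zeval map_polyC hornerC mulrC mulrzr.
- exact: pdiv_prime.
- exact: dvdn_trans (pdiv_dvd m) mn.
move=> d pdn pd; congr (b (_ %/ _)%N).
have pp : prime (pdiv m) by exact: pdiv_prime.
apply/eqP; rewrite eqn_dvd !dvdn_lcm Gauss_dvd ?prime_coprime //.
rewrite !dvdn_lcmr !dvdn_lcml (dvdn_trans (pdiv_dvd m)) ?dvdn_lcmr //=.
by rewrite (dvdn_trans _ (dvdn_lcml _ _)) // dvdn_mull.
Qed.

(** An element of [mu_ n] of order [m] forces [m %| n], so [n] has the form [m * N]; the derivatives
    are then the coefficients of t and t^2, the latter doubled. *)
Lemma q_gauss_order3_of_uniform (R : realType) (a : nat -> {poly int})
    (b : nat -> algC) :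
  (forall m N (w : algC), m.-primitive_root w -> zeval w (a (m * N)%N) = b N) ->
  (forall m N, uniform R[i] m (a (m * N)%N)) ->
  q_gauss_order R 3 a.
Proof.
move=> ab ua; split; first exact: q_gauss_of_zeval ab.
move=> n j n0 j12 m w w' wn _ pw pw'.
have : (m %| n)%N.
  by rewrite (prim_order_dvd pw) -unity_rootE; apply: mu_unity_root wn.
move=> /dvdnP[N ->]; rewrite mulnC; have u := ua m N w w' pw pw'.
case: j j12 => [|[|[|]]] // _.
  by have := u 1%N isT; rewrite !expansion_coef1 !expr1.
have := congr1 (fun x => x *+ 2) (u 2 isT).
by rewrite !expansion_coef2.
Qed.

Theorem theorem1p3 (R : realType) :
  (forall a b : nat, (1 <= b)%N -> (b <= a)%N ->
     q_gauss_order R 3 (f_seq a b)) /\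
  (forall A B : int,
     (forall n k : nat, 0 <= g_exp A B n k) ->
     q_gauss_order R 3 (g_seq A B)) /\
  (forall A B C D : int,
     (forall n k l : nat, 0 <= h_exp A B C D n k l) ->
     q_gauss_order R 3 (h_seq A B C D)).
Proof.
split=> [a b _ _|].
  (* By q-Lucas the value is the same binomial at q = 1, with both indices divided by [m]. *)
  apply: (@q_gauss_order3_of_uniform _ _ (fun N => 'C(a * N, b * N)%:R)).
    move=> m N w pw; rewrite /f_seq !(mulnCA _ m).
    have := zeval_qbinom_mulm pw (a * N) (b * N) (prim_order_gt0 pw).
    by rewrite addn0.
  by move=> m N; rewrite /f_seq !(mulnCA _ m); apply: uniform_qbinom.
split=> [A B f0|A B C D f0]; apply: q_gauss_order3_of_uniform.
- by move=> m N w pw; apply: zeval_g_seq.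
- by move=> m N; apply: uniform_g_seq.
- by move=> m N w pw; apply: zeval_h_seq.
- by move=> m N; apply: uniform_h_seq.
Qed.
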